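(* Let $m\ge3$ be an odd integer. Let $X$ be a centered Gaussian process with canonical metric $\delta^2(s,t):=\mathbf{E}[(X_t-X_s)^2]$, covariance $Q(s,t)=\mathbf{E}[X_sX_t]$ and variance $Q_u:=\mathrm{Var}[X_u]$. Assume: - There is a univariate increasing and concave function, also denoted $\delta^2$ (with $\delta\ge0$), such that $\delta(r)=o\left(r^{1/(2m)}\right)$ for $r$ near $0$ and $\delta^2(s,t)\le\delta^2(|t-s|)$ for all $s,t$. - In the sense of distributions, the mixed second derivative $\partial^2\delta^2/(\partial s\,\partial t)$ of the bivariate $\delta^2$ is a signed $\sigma$-finite measure $\mu$ off the diagonal, and for some constant $C$ and all $\varepsilon>0$ small enough, $|\mu|\left(\{(s,t):0\le s\le t-\varepsilon\le1\}\right)\le C\,\varepsilon^{-(m-1)/m}$, where $|\mu|$ is the total variation measure of $\mu$. - For $u<v$, the functions $u\mapsto Q_u$, $v\mapsto\delta^2(u,v)$ and $u\mapsto-\delta^2(u,v)$ are increasing and concave. - There exist positive constants $a>1$, $b<1/2$, $c>1/4$ and $c'>0$ such that, for all small $\varepsilon>0$ and all $\varepsilon<u<v\le1$, (i) $c\,\delta^2(u)\le Q_u$; (ii) $c'\,\delta^2(u)\,\delta^2(v-u)\le Q_uQ_v-Q^2(u,v)$; (iii) $\displaystyle\frac{\delta(au)-\delta(u)}{(a-1)u}<b\,\frac{\delta(u)}{u}$. Then for every bounded measurable function $g$ on $\mathbf{R}$, $$\lim_{\varepsilon\to0}\frac1{\varepsilon^2}\,\mathbf{E}\left[\left(\int_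0^1du\,(X_{u+\varepsilon}-X_u)^m\,g\left(\frac{X_{u+\varepsilon}+X_u}{2}\right)\right)^2\right]=0.$$
   Context: Fix $\varepsilon_0>0$. The process $X$ is indexed by $[0,1+\varepsilon_0]$, so that $X_{u+\varepsilon}$ makes sense for $u\in[0,1]$ and $0<\varepsilon\le\varepsilon_0$; the bivariate $\delta^2$ is defined on $[0,1+\varepsilon_0]^2$, the univariate $\delta^2$ on $[0,1+\varepsilon_0]$, and $\mu$ lives on $[0,1+\varepsilon_0]^2\setminus\{(s,s)\}$. In (i)-(iii), a one-argument $\delta$ is the univariate function and (iii) is required whenever $au$ lies in its domain. It is a standing assumption that $X$ is represented as $X_t=\int_0^{1+\varepsilon_0}G(t,s)\,dW(s)$ with $W$ a standard Brownian motion and $G$ a non-random measurable kernel with $G(t,\cdot)$ square-integrable for every $t$. *)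

(* Defs.v *)
From HB Require Import structures.
From mathcomp Require Export all_boot all_order all_algebra.
From mathcomp Require Export all_classical all_reals all_analysis.

Set Implicit Arguments.
Unset Strict Implicit.
Unset Printing Implicit Defensive.

Export Order.TTheory GRing.Theory Num.Theory.
Export numFieldNormedType.Exports.

Local Open Scope classical_set_scope.
Local Open Scope ring_scope.

(* Processes are indexed by the whole line, but only the values at times in
   [0, T] are ever constrained or used. *)

Section gaussian.
Context (d : measure_display) (Omega : measurableType d) (R : realType).
Variable P : probability Omega R.

(* The variance [v] may be 0; that case is split off because
   [normal_prob m 0] is not the Dirac mass at [m]. *)
Definition gaussian_law (Y : Omega -> R) (m v : R) : Prop :=
  forall B : set R, measurable B ->
    P (Y @^-1` B) =
      (if v == 0 then \d_m B else normal_prob m (Num.sqrt v) B).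

Definition gaussian_process (T : R) (X : R -> {RV P >-> R}) : Prop :=
  forall (n : nat) (t a : 'I_n -> R), (forall i, 0 <= t i <= T) ->
    exists m v : R, 0 <= v /\
      gaussian_law (fun w => \sum_(i < n) a i * X (t i) w) m v.

Definition independent_increments (T : R) (W : R -> {RV P >-> R}) : Prop :=
  forall (n : nat) (t : nat -> R) (B : 'I_n -> set R),
    (forall i, 0 <= t i <= T) -> (forall i, t i <= t i.+1) ->
    (forall i, measurable (B i)) ->
    P [set w | forall i : 'I_n, B i (W (t i.+1) w - W (t i) w)] =
    (\prod_(i < n) P [set w | B i (W (t i.+1) w - W (t i) w)%R])%E.

Definition standard_brownian_motion (T : R) (W : R -> {RV P >-> R}) : Prop :=
  [/\ {ae P, forall w, W 0 w = 0},
      independent_increments T W,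
      forall s t : R, 0 <= s -> s <= t -> t <= T ->
        gaussian_law (fun w => W t w - W s w) 0 (t - s) &
      {ae P, forall w, {within `[0, T], continuous (fun t => W t w)}}].

(* A step function is encoded as a list of triples (c, (a, b)), standing for
   the sum of the functions c 1_(a, b]. *)
Definition step_fun (l : seq (R * (R * R))) (x : R) : R :=
  \sum_(k <- l) k.1 * \1_(`]k.2.1, k.2.2]) x.

Definition step_wiener (W : R -> {RV P >-> R}) (l : seq (R * (R * R)))
    (w : Omega) : R :=
  \sum_(k <- l) k.1 * (W k.2.2 w - W k.2.1 w).

(* [Y] is (a version of) the Wiener integral of [f] over [0, T]: the L^2(P)
   limit of the elementary integrals of step functions converging to [f] in
   L^2([0, T]). *)
Definition is_wiener_integral (T : R) (W : R -> {RV P >-> R})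
    (f : R -> R) (Y : Omega -> R) : Prop :=
  exists l : nat -> seq (R * (R * R)),
    [/\ forall n k, k \in l n -> 0 <= k.2.1 /\ k.2.1 <= k.2.2 /\ k.2.2 <= T,
        (\int[lebesgue_measure]_(x in `[0%R, T])
           ((f x - step_fun (l n) x) ^+ 2)%:E)%E @[n --> \oo] --> 0%E &
        ('E_P[fun w => ((Y w - step_wiener W (l n) w) ^+ 2)%R])%E
           @[n --> \oo] --> 0%E].

Definition canonical_metric (X : R -> {RV P >-> R}) (s t : R) : R :=
  fine ('E_P[fun w => ((X t w - X s w) ^+ 2)%R])%E.

Definition cov (X : R -> {RV P >-> R}) (s t : R) : R :=
  fine ('E_P[fun w => (X s w * X t w)%R])%E.

Definition var (X : R -> {RV P >-> R}) (u : R) : R := fine ('V_P[X u])%E.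

End gaussian.

Section real_functions.
Variable R : realType.

Definition increasing_concave (D : set R) (f : R -> R) : Prop :=
  {in D &, {homo f : x y / x <= y}} /\ convex_function D (fun x => - f x).

End real_functions.

Section distributions.
Variable R : realType.

Local Notation plane := (measurableTypeR R * measurableTypeR R)%type.

Fixpoint Cdiff (n : nat) (f : R^o * R^o -> R^o) : Prop :=
  if n is k.+1 then
    [/\ continuous f,
        forall p, derivable f p (1, 0), forall p, derivable f p (0, 1),
        Cdiff k ('D_(1, 0) f) & Cdiff k ('D_(0, 1) f)]
  else continuous f.

Definition test_function (U : set (R^o * R^o)) (phi : R^o * R^o -> R^o) : Prop :=
  [/\ forall n, Cdiff n phi,
      compact (closure [set p | phi p != 0]) &
      closure [set p | phi p != 0] `<=` U].

Definition off_diagonal (T : R) : set (R * R) :=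
  [set p | [/\ 0 <= p.1 <= T, 0 <= p.2 <= T & p.1 != p.2]].

Definition open_off_diagonal (T : R) : set (R * R) :=
  [set p | [/\ 0 < p.1 < T, 0 < p.2 < T & p.1 != p.2]].

(* A signed sigma-finite measure on [D], given by its Jordan decomposition
   [mup - mun]; both parts may have infinite mass, so the library's charges,
   which are finite, do not cover it. *)
Definition signed_sigma_finite (D : set plane)
    (mup mun : {measure set plane -> \bar R}) : Prop :=
  [/\ sigma_finite D mup, sigma_finite D mun &
      exists N : set plane,
        [/\ measurable N, mup (D `&` N) = 0%E & mun (D `\` N) = 0%E]].

(* Value on subsets of [D] of the total variation of a signed measure on [D]
   given as above by its Jordan decomposition. *)
Definition total_variation (mup mun : {measure set plane -> \bar R})
    (A : set plane) : \bar R := (mup A + mun A)%E.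

Definition mixed_derivative_off_diagonal (T : R) (F : R -> R -> R)
    (mup mun : {measure set plane -> \bar R}) : Prop :=
  forall phi : R^o * R^o -> R^o, test_function (open_off_diagonal T) phi ->
    [/\ mup.-integrable (off_diagonal T) (fun p => (phi p)%:E),
        mun.-integrable (off_diagonal T) (fun p => (phi p)%:E) &
        (\int[(lebesgue_measure \x lebesgue_measure)%E]_(p in `[0%R, T] `*` `[0%R, T])
            (F p.1 p.2 * 'D_(1, 0) ('D_(0, 1) phi) p)%:E
         = \int[mup]_(p in off_diagonal T) (phi p)%:E
           - \int[mun]_(p in off_diagonal T) (phi p)%:E)%E].

End distributions.

(* Main.v *)
Require Import Defs.
From mathcomp Require Import measurable_realfun ring lra.

(** The hypothesis that drives the proof is the concavity of
    u |-> - delta^2(u, v) on [0, v): the function u |-> delta^2(u, v) is convex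
    there, and it tends to 0 as u tends to v because it is dominated by the
    univariate delta^2(v - u). It therefore lies below the chord joining
    (0, delta^2(0, v)) to (v, 0) ([canonical_metric_chord_le]):
<<
      delta^2(u, v) <= (1 - u / v) * delta^2(v).
>>
    With v = u + e, the variance of the increment X_(u+e) - X_u is at most
    e / (u + e) * delta^2(u + e): away from time 0 it is of order e.

    This is strong enough for the crudest treatment of the square. By
    Cauchy-Schwarz in time and Tonelli ([expectation_sqr_Rintegral_le]), and
    with M a bound for g, the expectation is at most M^2 times the integral over
    u in [0, 1] of E[(X_(u+e) - X_u)^(2m)]. Even moments of a Gaussian variable
    are controlled by its second moment ([gaussian_even_moment_le]), so the
    integrand is at most K * (e / (u + e) * delta^2(u + e))^m.

    It remains to see that this integrates to o(e^2). For every eta > 0, the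
    hypothesis delta(r) = o(r^(1/(2m))) gives delta(r)^(2m) <= eta r near 0;
    since delta is bounded, delta(r)^(2m) <= eta r + B r^3 on the whole interval
    for some B ([root_modulus_pow_le]). As e / (u + e) <= 1 and m >= 3, the
    integrand is at most K e^2 (eta e / (u + e)^2 + B e) ([chord_pow_le]). The
    integral of e / (u + e)^2 over [0, 1] is at most 1, hence the whole
    expectation is at most M^2 K e^2 (eta + B e)
    ([weighted_variation_second_moment_le]). Divide by e^2, let e tend to 0,
    then eta. *)

Set Implicit Arguments.
Unset Strict Implicit.
Unset Printing Implicit Defensive.

Local Open Scope classical_set_scope.
Local Open Scope ring_scope.

(** * Even moments of Gaussian variables *)

Section normal_moments.
Variable R : realType.
Implicit Types m s : R.
Local Notation mu := (@lebesgue_measure R).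

(** [normal_pdf m s] and the Radon-Nikodym derivative of [normal_prob m s] have
    the same integral over every measurable set, so they agree almost
    everywhere. *)
Lemma ge0_integral_normal_prob m s (f : measurableTypeR R -> \bar R) :
  measurable_fun setT f -> (forall x, 0 <= f x)%E ->
  (\int[normal_prob m s]_x f x = \int[mu]_x (f x * (normal_pdf m s x)%:E))%E.
Proof.
move=> mf f0; have dom := normal_prob_dominates m s.
rewrite -(Radon_Nikodym_SigmaFinite.change_of_variables dom)//.
have mpdf : measurable_fun [set: R] (fun x => (normal_pdf m s x)%:E).
  apply/measurable_EFinP.
  exact: measurable_normal_pdf.
apply: ae_eq_integral => //.
- apply: emeasurable_funM; first exact: mf.
  exact: measurable_int (Radon_Nikodym_SigmaFinite.f_integrable dom).
- exact: emeasurable_funM.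
- apply: ae_eqe_mul2l; apply: integral_ae_eq => //.
    exact: Radon_Nikodym_SigmaFinite.f_integrable.
  by move=> E _ mE; rewrite -Radon_Nikodym_SigmaFinite.f_integral.
Qed.

Lemma expr_le_fact_expR k (x : R) : 0 <= x -> x ^+ k <= k`!%:R * expR x.
Proof.
case: k => [|k] x0.
  by rewrite expr0 fact0 mul1r (le_trans _ (expR_ge1Dx _))// lerDl.
have := expR_ge1Dxn k x0.
have k0 : 0 < (k.+1)`!%:R :> R by rewrite ltr0n fact_gt0.
by rewrite -(ler_pM2l k0) mulrDr mulr1 mulrC divfK ?gt_eqF//; lra.
Qed.

Definition normal_moment_ub k : R := 8 ^+ k * k`!%:R * expR 1 * Num.sqrt 2.

Lemma normal_moment_ub_ge0 k : 0 <= normal_moment_ub k.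
Proof. by rewrite /normal_moment_ub !mulr_ge0 ?exprn_ge0 ?expR_ge0. Qed.

(** With q = (x - m)^2 / (4 s^2), a power of x^2 is at most a constant times
    a power of (m^2 + s^2) (1 + q), hence is dominated by expR q; and expR q
    turns the density of variance s^2 into a multiple of the one of variance
    2 s^2. *)
Lemma even_power_normal_pdf_le m s k (x : R) : 0 < s ->
  x ^+ (2 * k) * normal_pdf m s x
    <= normal_moment_ub k * (m ^+ 2 + s ^+ 2) ^+ k
       * normal_pdf m (Num.sqrt 2 * s) x.
Proof.
move=> s0; have sqrt2 : 0 < Num.sqrt 2 :> R by rewrite sqrtr_gt0.
have sqrt22 : Num.sqrt 2 ^+ 2 = 2 :> R by rewrite sqr_sqrtr.
have ps0 : Num.sqrt 2 * s != 0 by rewrite gt_eqF// mulr_gt0.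
have s20 : 0 < s ^+ 2 by rewrite exprn_gt0.
have A0 : 0 <= m ^+ 2 + s ^+ 2 by rewrite addr_ge0 ?sqr_ge0.
set q := (x - m) ^+ 2 / (4 * s ^+ 2).
have q0 : 0 <= q by rewrite divr_ge0 ?sqr_ge0// mulr_ge0// ltW.
have qE : (x - m) ^+ 2 = 4 * s ^+ 2 * q.
  by rewrite /q; field; rewrite gt_eqF.
have x2 : x ^+ 2 <= 8 * (m ^+ 2 + s ^+ 2) * (1 + q).
  have h : x ^+ 2 <= 2 * (m ^+ 2 + (x - m) ^+ 2).
    by have := sqr_ge0 (x - 2 * m); nra.
  by rewrite (le_trans h)// qE; have := sqr_ge0 m; nra.
have pdfE : normal_pdf m s x * expR q =
    Num.sqrt 2 * normal_pdf m (Num.sqrt 2 * s) x.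
  rewrite !normal_pdfE ?(gt_eqF s0)// /normal_fun.
  have -> : normal_peak s = Num.sqrt 2 * normal_peak (Num.sqrt 2 * s).
    rewrite /normal_peak exprMn sqrt22 -(mulrA 2) -(mulrnAr 2).
    rewrite (sqrtrM (_ *+ 2))//.
    by rewrite invfM mulrA divff ?gt_eqF// mul1r.
  rewrite -!mulrA; congr (_ * (_ * _)); rewrite -expRD; congr expR.
  by rewrite exprMn sqrt22 /q; field; rewrite gt_eqF.
have step : x ^+ (2 * k)
    <= 8 ^+ k * (m ^+ 2 + s ^+ 2) ^+ k * (k`!%:R * expR 1 * expR q).
  apply: (@le_trans _ _ ((8 * (m ^+ 2 + s ^+ 2) * (1 + q)) ^+ k)).
    by rewrite exprM lerXn2r// nnegrE ?sqr_ge0// (le_trans _ x2)// sqr_ge0.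
  rewrite !exprMn ler_wpM2l//; first by rewrite mulr_ge0 ?exprn_ge0.
  by rewrite -mulrA -expRD expr_le_fact_expR// addr_ge0.
apply: (le_trans (ler_wpM2r (normal_pdf_ge0 m s x) step)).
rewrite -(mulrA _ (_ * expR 1 * _)) -(mulrA _ (expR q)) (mulrC (expR q)) pdfE.
by rewrite /normal_moment_ub le_eqVlt; apply/orP; left; apply/eqP; ring.
Qed.

Lemma normal_prob_even_moment_le m s k : 0 < s ->
  (\int[normal_prob m s]_x ((x ^+ (2 * k))%:E)
    <= (normal_moment_ub k * (m ^+ 2 + s ^+ 2) ^+ k)%:E)%E.
Proof.
move=> s0.
have mX : measurable_fun setT (fun x : R => (x ^+ (2 * k))%:E).
  by apply/measurable_EFinP; exact: measurable_funX.
have X0 (x : R) : (0 <= (x ^+ (2 * k))%:E)%E.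
  by rewrite lee_fin exprM exprn_ge0 ?sqr_ge0.
have mpdf t : measurable_fun [set: R] (fun x => (normal_pdf m t x)%:E).
  by apply/measurable_EFinP; exact: measurable_normal_pdf.
have c0 : 0 <= normal_moment_ub k * (m ^+ 2 + s ^+ 2) ^+ k.
  by rewrite mulr_ge0 ?normal_moment_ub_ge0 ?exprn_ge0 ?addr_ge0 ?sqr_ge0.
rewrite ge0_integral_normal_prob//.
have -> : (normal_moment_ub k * (m ^+ 2 + s ^+ 2) ^+ k)%:E =
    (\int[mu]_x ((normal_moment_ub k * (m ^+ 2 + s ^+ 2) ^+ k)%:E *
      (normal_pdf m (Num.sqrt 2 * s) x)%:E))%E.
  by rewrite integralZl ?integral_normal_pdf ?mule1//;
    exact: integrable_normal_pdf.
apply: ge0_le_integral => //.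
- by move=> x _; rewrite mule_ge0// lee_fin normal_pdf_ge0.
- by apply: emeasurable_funM; [exact: mX|exact: mpdf].
- by apply: emeasurable_funM; [exact: measurable_cst|exact: mpdf].
by move=> x _; rewrite -!EFinM lee_fin even_power_normal_pdf_le.
Qed.

(** A lower bound for the mass that a normal law with standard deviation s gives
    to an interval of length s within distance 2 s of its mean. *)
Definition normal_sqr_lb : R := normal_peak 1 * expR (- 2).

Lemma normal_sqr_lb_gt0 : 0 < normal_sqr_lb.
Proof. by rewrite mulr_gt0 ?expR_gt0// normal_peak_gt0. Qed.

(** The square of a number between m + s and m + 2 s (or m - 2 s and m - s,
    when m < 0) is at least m^2 + s^2, and this interval has mass at least
    [normal_sqr_lb]. *)
Lemma normal_prob_second_moment_ge m s : 0 < s ->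
  ((normal_sqr_lb * (m ^+ 2 + s ^+ 2))%:E
    <= \int[normal_prob m s]_x ((x ^+ 2)%:E))%E.
Proof.
move=> s0.
have [I [mI muI xI xI2]] : exists I : set R, [/\ measurable I, mu I = s%:E,
   forall x, I x -> (x - m) ^+ 2 <= 4 * s ^+ 2 &
   forall x, I x -> m ^+ 2 + s ^+ 2 <= x ^+ 2].
  have [m0|m0] := leP 0 m.
    exists `[m + s, m + 2 * s]%classic; split => //.
    - rewrite lebesgue_measure_itv/= lte_fin ifT; last by lra.
      by rewrite -EFinB; congr EFin; ring.
    - by move=> x /=; rewrite in_itv/= => /andP[h1 h2]; nra.
    - by move=> x /=; rewrite in_itv/= => /andP[h1 h2]; nra.
  exists `[m - 2 * s, m - s]%classic; split => //.
  - rewrite lebesgue_measure_itv/= lte_fin ifT; last by lra.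
    by rewrite -EFinB; congr EFin; ring.
  - by move=> x /=; rewrite in_itv/= => /andP[h1 h2]; nra.
  - by move=> x /=; rewrite in_itv/= => /andP[h1 h2]; nra.
have s20 : 0 < s ^+ 2 by rewrite exprn_gt0.
have PI : (normal_sqr_lb%:E <= normal_prob m s I)%E.
  have -> : normal_sqr_lb%:E =
      (\int[mu]_(x in I) (normal_peak s * expR (- 2))%:E)%E.
    rewrite integral_cst// [X in (_ * X)%E]muI -EFinM; congr EFin.
    rewrite /normal_sqr_lb /normal_peak expr1n mul1r -mulrnAr sqrtrM ?sqr_ge0//.
    rewrite sqrtr_sqr gtr0_norm// invfM; field.
    by rewrite !gt_eqF// sqrtr_gt0 mulrn_wgt0// pi_gt0.
  apply: ge0_le_integral => //.
  - by move=> x _; rewrite lee_fin mulr_ge0 ?normal_peak_ge0 ?expR_ge0.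
  - by apply/measurable_EFinP/measurable_funTS; exact: measurable_normal_pdf.
  move=> x Ix; rewrite lee_fin normal_pdfE ?gt_eqF//.
  rewrite ler_wpM2l ?normal_peak_ge0//.
  rewrite ler_expR mulNr lerN2 ler_pdivrMr ?pmulrn_lgt0//.
  by rewrite (le_trans (xI _ Ix))// -mulr_natr; nra.
apply: (@le_trans _ _ (\int[normal_prob m s]_(x in I) (m ^+ 2 + s ^+ 2)%:E)%E).
  rewrite integral_cst//= EFinM muleC lee_wpmul2l// lee_fin addr_ge0 ?sqr_ge0//.
apply: (@le_trans _ _ (\int[normal_prob m s]_(x in I) (x ^+ 2)%:E)%E).
  apply: ge0_le_integral => //.
  - by move=> x _; rewrite lee_fin addr_ge0 ?sqr_ge0.
  - by apply/measurable_EFinP/measurable_funTS; exact: measurable_funX.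
apply: ge0_subset_integral => //.
- by apply/measurable_EFinP; exact: measurable_funX.
- by move=> x _; rewrite lee_fin sqr_ge0.
Qed.

End normal_moments.

Definition gaussian_moment_const (R : realType) (k : nat) : R :=
  1 + normal_moment_ub R k / normal_sqr_lb R ^+ k.

Lemma gaussian_moment_const_ge0 (R : realType) k :
  0 <= gaussian_moment_const R k.
Proof.
rewrite addr_ge0// divr_ge0 ?normal_moment_ub_ge0//.
by rewrite exprn_ge0// ltW// normal_sqr_lb_gt0.
Qed.

Section gaussian_moments.
Context (d : measure_display) (Omega : measurableType d) (R : realType).
Variable P : probability Omega R.

Lemma ge0_expectation_gaussian_law (Y : {RV P >-> R}) m v (h : R -> R) :
  gaussian_law P Y m v -> measurable_fun [set: R] h -> (forall x, 0 <= h x) ->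
  ('E_P[h \o Y])%E = if v == 0 then (h m)%:E
    else (\int[normal_prob m (Num.sqrt v)]_x (h x)%:E)%E.
Proof.
move=> YG mh h0; have mEh : measurable_fun [set: R] (EFin \o h).
  exact/measurable_EFinP.
have h0E (x : R) : (0 <= (h x)%:E)%E by rewrite lee_fin.
(* [normal_prob] is a measure on [measurableTypeR R], whose sigma-algebra has
   the same sets as the one on R but is another structure: Y is pushed forward
   to that type. *)
have mY : measurable_fun [set: Omega] (Y : Omega -> measurableTypeR R).
  exact: (@measurable_funPT _ _ _ _ Y).
have mT : measurable [set: measurableTypeR R] by [].
have := @ge0_integral_pushforward _ _ Omega (measurableTypeR R) R _ mY P setT
  (EFin \o h) mT mEh.
rewrite preimage_setT unlock => <-; last by move=> x _; exact: h0E.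
have [v0|v0] := eqVneq v 0.
  transitivity (\int[\d_(m : measurableTypeR R)]_x (h x)%:E)%E.
    apply: eq_measure_integral => A mA _.
    by have /= := YG A mA; rewrite v0 eqxx.
  by rewrite integral_dirac// diracT mul1e.
apply: eq_measure_integral => A mA _.
by have /= := YG A mA; rewrite (negbTE v0).
Qed.

(** Both moments are compared with m^2 + v. The summand 1 of the constant takes
    care of the Dirac mass, for which equality holds with constant 1. *)
Lemma gaussian_even_moment_le (Y : {RV P >-> R}) (m v : R) k :
  0 <= v -> gaussian_law P Y m v ->
  ('E_P[fun w => (Y w ^+ 2)%R])%E \is a fin_num /\
  ('E_P[fun w => (Y w ^+ (2 * k))%R]
    <= (gaussian_moment_const R k
        * fine ('E_P[fun w => (Y w ^+ 2)%R])%E ^+ k)%:E)%E.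
Proof.
move=> v0 YG; have moment n : ('E_P[fun w => (Y w ^+ (2 * n))%R])%E =
    if v == 0 then (m ^+ (2 * n))%:E
    else (\int[normal_prob m (Num.sqrt v)]_x (x ^+ (2 * n))%:E)%E.
  apply: (ge0_expectation_gaussian_law (h := fun x => x ^+ (2 * n)) YG).
    exact: measurable_funX.
  by move=> x; rewrite exprM exprn_ge0 ?sqr_ge0.
have := moment 1%N; rewrite muln1 => ->; rewrite moment.
have lb0 : 0 < normal_sqr_lb R by exact: normal_sqr_lb_gt0.
have ub0 : 0 <= normal_moment_ub R k by exact: normal_moment_ub_ge0.
have [//|vN0] := eqVneq v 0.
  split=> //=; rewrite lee_fin exprM ler_peMl//.
    by rewrite exprn_ge0 ?sqr_ge0.
  by rewrite lerDl divr_ge0// exprn_ge0// ltW.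
have s0 : 0 < Num.sqrt v by rewrite sqrtr_gt0 lt0r vN0.
have s2 : Num.sqrt v ^+ 2 = v by rewrite sqr_sqrtr.
have A0 : 0 <= m ^+ 2 + v by rewrite addr_ge0 ?sqr_ge0.
have := normal_prob_even_moment_le m k s0.
have := normal_prob_second_moment_ge m s0.
have := normal_prob_even_moment_le m 1 s0; rewrite muln1 expr1 s2.
set E2 := (\int[_]_x _)%E => E2ub E2lb Ek.
have E2fin : E2 \is a fin_num.
  rewrite ge0_fin_numE; first exact: le_lt_trans E2ub (ltry _).
  by apply: integral_ge0 => x _; rewrite lee_fin sqr_ge0.
split=> //; rewrite (le_trans Ek)// lee_fin mulrDl mul1r.
have /lerXn2r-/(_ k) : normal_sqr_lb R * (m ^+ 2 + v) <= fine E2.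
  by rewrite -lee_fin fineK.
have E20 : 0 <= fine E2.
  by rewrite fine_ge0// integral_ge0// => x _; rewrite lee_fin sqr_ge0.
rewrite !nnegrE mulr_ge0 ?(ltW lb0)// => /(_ isT E20); rewrite exprMn => h.
rewrite -[leLHS]add0r lerD ?exprn_ge0// -mulrA ler_wpM2l//.
by rewrite mulrC ler_pdivlMr ?exprn_gt0// mulrC.
Qed.

End gaussian_moments.

(** * Convexity and moduli of continuity *)

Section real_estimates.
Variable R : realType.

Local Open Scope convex_scope.

(** Let w tend to v in the convexity inequality for u between 0 and w. *)
Lemma convex_vanishing_le (f : R -> R) (u v : R) : 0 <= u -> u < v ->
  convex_function `[0, v[ f -> f w @[w --> v^'-] --> 0 ->
  f u <= (1 - u / v) * f 0.
Proof.
move=> u0 uv cf fv; have v0 : 0 < v by lra.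
have chord w : u < w -> w < v -> f u <= (1 - u / w) * f 0 + u / w * f w.
  move=> uw wv; have w0 : 0 < w by lra.
  have t0 : 0 <= 1 - u / w by rewrite subr_ge0 ler_pdivrMr// mul1r ltW.
  have t1 : 1 - u / w <= 1 by rewrite lerBlDr lerDl divr_ge0// ltW.
  have := cf (Itv01 t0 t1) 0 w.
  rewrite !inE/= !in_itv/= lexx v0 (ltW w0) wv => /(_ isT isT).
  have -> : ((0 : convex_lmodType R^o) <| Itv01 t0 t1 |> w) = u.
    transitivity ((1 - u / w) * 0 + (1 - (1 - u / w)) * w) => //.
    by field; rewrite gt_eqF.
  by move=> h; rewrite -[X in X * f w](subKr 1); exact: h.
have -> : (1 - u / v) * f 0 = (1 - u / v) * f 0 + u / v * 0.
  by rewrite mulr0 addr0.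
have inv : u / w @[w --> v^'-] --> u / v.
  apply: cvgM; first exact: cvg_cst.
  apply: cvgV; first by rewrite gt_eqF.
  exact: cvg_at_left_filter.
apply: (@cvgr_to_ge _ v^'- _ _ (fun w => (1 - u / w) * f 0 + u / w * f w)).
  apply: cvgD; last exact: cvgM.
  by apply: cvgM; [apply: cvgB => //; exact: cvg_cst|exact: cvg_cst].
near=> w; apply: chord.
  by near: w; exact: nbhs_left_gt.
by near: w; exact: nbhs_left_lt.
Unshelve. all: by end_near. Qed.

Lemma littleo_root_pow_le (f : R -> R) (n : nat) (eta : R) :
  (0 < n)%N -> 0 < eta ->
  f =o_ (0^'+) (fun r => r `^ n%:R^-1) ->
  \forall r \near 0^'+, `|f r| ^+ n <= eta * r.
Proof.
move=> n0 eta0 /eqoP fo.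
have nR0 : n%:R != 0 :> R by rewrite pnatr_eq0 -lt0n.
have root (x : R) : 0 < x -> (x `^ n%:R^-1) ^+ n = x.
  by move=> x0; rewrite -powR_mulrn ?powR_ge0// -powRrM mulVf// powRr1// ltW.
have c0 : 0 < eta `^ n%:R^-1 by rewrite powR_gt0.
near=> r.
have r0 : 0 < r by near: r; exact: nbhs_right_gt.
have fr : `|f r| <= eta `^ n%:R^-1 * `|r `^ n%:R^-1|.
  by near: r; exact: fo.
rewrite -[X in X * _](root eta)// -[X in _ * X](root r)// -exprMn.
rewrite (ger0_norm (powR_ge0 _ _)) in fr.
by rewrite lerXn2r// nnegrE// mulr_ge0 ?powR_ge0.
Unshelve. all: by end_near. Qed.

(** With r = u + e the factor 1 - u / r is e / r <= 1, so that its m-th power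
    is at most its cube; and (e / r)^3 (eta r + B r^3) is the right-hand
    side. *)
Lemma chord_pow_le (m : nat) (e u eta B S : R) :
  (3 <= m)%N -> 0 < e -> 0 <= u ->
  S ^+ m <= eta * (u + e) + B * (u + e) ^+ 3 -> 0 <= S ->
  ((1 - u / (u + e)) * S) ^+ m <= e ^+ 2 * (eta * (e / (u + e) ^+ 2) + B * e).
Proof.
move=> m3 e0 u0 Sm S0; have r0 : 0 < u + e by lra.
have -> : 1 - u / (u + e) = e / (u + e) by field; rewrite gt_eqF.
have q0 : 0 <= e / (u + e) by rewrite divr_ge0 ?ltW.
have q1 : e / (u + e) <= 1 by rewrite ler_pdivrMr// mul1r lerDr.
rewrite exprMn.
apply: (@le_trans _ _
  ((e / (u + e)) ^+ 3 * (eta * (u + e) + B * (u + e) ^+ 3))).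
  by rewrite ler_pM ?exprn_ge0// ler_wiXn2l.
rewrite le_eqVlt; apply/orP; left; apply/eqP; field; rewrite gt_eqF//.
Qed.

Lemma continuous_sqr_inv_shift (e : R) : 0 < e ->
  {within `[0, 1], continuous (fun u : R => e / (u + e) ^+ 2)}.
Proof.
move=> e0; apply: continuous_in_subspaceT => u.
rewrite inE/= in_itv/= => /andP[u0 _].
have cinv : (x + e)^-1 @[x --> u] --> (u + e)^-1.
  apply: cvgV; first by rewrite gt_eqF//; lra.
  by apply: cvgD; [exact: cvg_id|exact: cvg_cst].
apply: cvgM; first exact: cvg_cst.
rewrite -exprVn; under eq_fun do rewrite -exprVn.
exact: (cvgM cinv cinv).
Qed.

(** The antiderivative - e / (u + e) shows that the value is 1 - e / (1 + e). *)
Lemma integral_sqr_inv_shift_le1 (e : R) : 0 < e ->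
  (\int[lebesgue_measure]_(u in `[0%R, 1%R]) (e / (u + e) ^+ 2)%:E <= 1)%E.
Proof.
move=> e0.
have pos (u : R) : 0 <= u -> u + e != 0 by move=> u0; rewrite gt_eqF//; lra.
have dinv (u : R) : 0 <= u ->
    is_derive u (1 : R) (fun x : R => (x + e)^-1) (- (u + e) ^- 2).
  move=> u0; have dshift : is_derive u (1 : R) (fun x : R => x + e) 1.
    by apply: is_derive_eq; rewrite addr0.
  have := @is_deriveV _ (fun x => x + e) _ _ _ (pos _ u0) dshift.
  by rewrite scaler1.
have dF (u : R) : 0 <= u ->
    is_derive u (1 : R) (fun x => - e * (x + e)^-1) (e / (u + e) ^+ 2).
  move=> u0; have := is_deriveZ (- e) (dinv u u0).
  by rewrite scalerN scaleNr opprK.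
have cinv (u : R) : 0 <= u -> (x + e)^-1 @[x --> u] --> (u + e)^-1.
  move=> u0; apply: cvgV; first exact: pos.
  by apply: cvgD; [exact: cvg_id|exact: cvg_cst].
have cF (u : R) : 0 <= u -> - e * (x + e)^-1 @[x --> u] --> - e * (u + e)^-1.
  by move=> u0; apply: cvgM; [exact: cvg_cst|exact: cinv].
rewrite (@continuous_FTC2 _ _ (fun x => - e * (x + e)^-1))//.
- rewrite -EFinB lee_fin add0r !mulNr opprK divff ?gt_eqF//.
  by rewrite gerDr oppr_le0 divr_ge0//; lra.
- exact: continuous_sqr_inv_shift.
- split.
  + by move=> u; rewrite in_itv/= => /andP[/ltW/dF[]].
  + by apply: cvg_at_right_filter; exact: cF.
  + by apply: cvg_at_left_filter; exact: cF.
- move=> u; rewrite in_itv/= => /andP[/ltW/dF u0 _].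
  by rewrite derive1E derive_val.
Qed.

Section root_modulus.
Variables (T : R) (delta : R -> R) (m : nat).
Hypothesis m_gt0 : (0 < m)%N.
Hypothesis delta_root : delta =o_ (0^'+) (fun r => r `^ ((2 * m)%:R)^-1).

Let m2_gt0 : (0 < 2 * m)%N. Proof. by rewrite muln_gt0. Qed.

Lemma root_modulus_sqr_cvg0 : delta r ^+ 2 @[r --> 0^'+] --> 0.
Proof.
apply/cvgr0Pnorm_le => t t0; have tm0 : 0 < t ^+ m by rewrite exprn_gt0.
have := littleo_root_pow_le m2_gt0 ltr01 delta_root.
apply: filter_app; near=> r.
rewrite mul1r exprM real_normK ?num_real// => dr.
have rt : r <= t ^+ m by near: r; exact: nbhs_right_le.
rewrite ger0_norm ?sqr_ge0// -(@ler_pXn2r _ m) ?nnegrE ?sqr_ge0 ?(ltW t0)//.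
exact: le_trans dr rt.
Unshelve. all: by end_near. Qed.

(** The bound eta r holds on some ]0, e[. For r >= e the term in r^3 alone
    suffices once B e^3 is the largest value of delta^(2m); the exponent 3 is
    the one that [chord_pow_le] cancels. *)
Lemma root_modulus_pow_le (eta : R) : 0 < eta ->
  (forall r, 0 < r -> r <= T -> delta r ^+ 2 <= delta T ^+ 2) ->
  exists2 B : R, 0 <= B &
    forall r, 0 < r -> r <= T -> (delta r ^+ 2) ^+ m <= eta * r + B * r ^+ 3.
Proof.
move=> eta0 dmax.
have [e /= e0 small] := littleo_root_pow_le m2_gt0 eta0 delta_root.
pose D := (delta T ^+ 2) ^+ m; have D0 : 0 <= D by rewrite exprn_ge0 ?sqr_ge0.
have B0 : 0 <= D / e ^+ 3 by rewrite divr_ge0// exprn_ge0// ltW.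
exists (D / e ^+ 3) => // r r0 rT.
have [re|er] := ltP r e.
  have := small r; rewrite /ball/= sub0r normrN gtr0_norm// => /(_ re r0).
  rewrite exprM real_normK ?num_real// => /le_trans; apply.
  by rewrite lerDl mulr_ge0// exprn_ge0// ltW.
apply: (@le_trans _ _ D).
  by rewrite lerXn2r ?nnegrE ?sqr_ge0// dmax.
rewrite -[leLHS]add0r lerD//; first by rewrite mulr_ge0// ltW.
rewrite mulrAC ler_pdivlMr ?exprn_gt0// ler_wpM2l// lerXn2r// nnegrE ltW//.
Qed.

End root_modulus.

End real_estimates.

(** * Squares of time integrals *)

(** Jensen's inequality for the square: with A the integral of f, integrate
    2 A f <= f^2 + A^2. *)
Lemma sqr_Rintegral_le d (T : measurableType d) (R : realType)
    (mu : {measure set T -> \bar R}) (D : set T) (f : T -> R) :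
  measurable D -> mu D = 1%E -> measurable_fun D f ->
  (((\int[mu]_(x in D) f x) ^+ 2)%:E <= \int[mu]_(x in D) (f x ^+ 2)%:E)%E.
Proof.
move=> mD D1 mf; set B := (\int[mu]_(x in D) (f x ^+ 2)%:E)%E.
have mf2 : measurable_fun D (fun x => (f x ^+ 2)%:E).
  by apply/measurable_EFinP; exact: measurable_funX.
have [->|Boo] := eqVneq B +oo%E; first by rewrite leey.
have if2 : mu.-integrable D (fun x => (f x ^+ 2)%:E).
  apply/integrableP; split=> //.
  under eq_integral do rewrite /= ger0_norm ?sqr_ge0//.
  by rewrite ltey.
have icst r : mu.-integrable D (fun _ => r%:E).
  apply/integrableP; split=> //.
  by rewrite /= integral_cst// [X in (_ * X)%E]D1 mule1 ltry.
have intf : mu.-integrable D (EFin \o f).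
  apply: (le_integrable mD (f := EFin \o f) (g := fun x => (1 + f x ^+ 2)%:E)).
  - exact/measurable_EFinP.
  - move=> x _; rewrite /= lee_fin [leRHS]ger0_norm ?addr_ge0 ?sqr_ge0//.
    have := sqr_ge0 (`|f x| - 1); rewrite -(real_normK (num_real (f x))).
    by have := normr_ge0 (f x); nra.
  exact: (integrableD mD (icst 1) if2).
set A := Rintegral _ _ _.
have -> : B = (\int[mu]_(x in D) (f x ^+ 2))%:E.
  by rewrite /Rintegral fineK//; exact: integrable_fin_num.
have h : \int[mu]_(x in D) (2 * A * f x)
      <= \int[mu]_(x in D) (f x ^+ 2 + A ^+ 2).
  apply: le_Rintegral => //.
  - exact: (integrableZl mD (2 * A) intf).
  - exact: (integrableD mD if2 (icst (A ^+ 2))).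
  - by move=> x _; have := sqr_ge0 (f x - A); nra.
move: h; rewrite (RintegralZl _ mD intf) (RintegralD mD if2 (icst _)).
by rewrite Rintegral_cst// D1 -/A mulr1 lee_fin; nra.
Qed.

(** [sqr_Rintegral_le] for each outcome, then Tonelli's theorem. *)
Lemma expectation_sqr_Rintegral_le d1 (T : measurableType d1)
    d2 (Omega : measurableType d2) (R : realType)
    (mu : {sigma_finite_measure set T -> \bar R}) (P : probability Omega R)
    (D : set T) (F : T * Omega -> R) (B : T -> \bar R) :
  measurable D -> mu D = 1%E -> measurable_fun setT F ->
  measurable_fun D B ->
  (forall u, D u -> 'E_P[fun w => (F (u, w) ^+ 2)%R] <= B u)%E ->
  ('E_P[fun w => ((\int[mu]_(u in D) F (u, w)) ^+ 2)%R]
     <= \int[mu]_(u in D) B u)%E.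
Proof.
move=> mD D1 mF mB FB.
pose FD := (fun p : T * Omega => (F p)%:E) \_ (D `*` setT).
have mFD : measurable_fun setT FD.
  apply/(measurable_restrictT (fun p => (F p)%:E) (measurableX mD measurableT)).
  by apply: measurable_funTS; apply: measurableT_comp.
have FDE w : (\int[mu]_(u in D) (F (u, w))%:E = \int[mu]_u FD (u, w))%E.
  rewrite integral_mkcond; apply: eq_integral => u _; rewrite /FD !patchE.
  by rewrite in_setX in_setT andbT.
have mI : measurable_fun setT (fun w => \int[mu]_(u in D) (F (u, w))%:E)%E.
  rewrite (_ : (fun w => _) =
      (fun w => fubini_G mu FD^\+ w - fubini_G mu FD^\- w))%E; last first.
    apply/funext => w; rewrite FDE [LHS]integralE /fubini_G.
    by congr (_ - _)%E; apply: eq_integral => u _; rewrite ?funeposE ?funenegE.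
  apply: emeasurable_funB; apply: measurable_fun_fubini_tonelli_G.
  - exact: measurable_funepos.
  - by move=> p; exact: funepos_ge0.
  - exact: measurable_funeneg.
  - by move=> p; exact: funeneg_ge0.
pose F2 (p : T * Omega) := ((F p ^+ 2) * \1_D p.1)%:E.
have mF2 : measurable_fun setT F2.
  apply/measurable_EFinP/measurable_funM; first exact: measurable_funX.
  by apply: (measurableT_comp (measurable_indic mD)); exact: measurable_fst.
have F20 p : (0 <= F2 p)%E by rewrite lee_fin mulr_ge0 ?sqr_ge0.
have mFw w : measurable_fun D (fun u => F (u, w)).
  by apply: measurable_funTS; exact: measurable_fun_pair1.
have F2E w : (\int[mu]_(u in D) (F (u, w) ^+ 2)%:E = \int[mu]_u F2 (u, w))%E.
  rewrite integral_mkcond; apply: eq_integral => u _; rewrite /F2 patchE indicE.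
  by case: ifPn => _; rewrite ?mulr1 ?mulr0.
rewrite unlock.
apply: (@le_trans _ _ (\int[P]_w \int[mu]_u F2 (u, w))%E).
  apply: ge0_le_integral => //.
  - by move=> w _; rewrite lee_fin sqr_ge0.
  - apply/measurable_EFinP/measurable_funX.
    exact: (measurableT_comp (fine_measurable measurableT) mI).
  - exact: (measurable_fun_fubini_tonelli_G F2 mF2 F20).
  - by move=> w _; rewrite -F2E; exact: sqr_Rintegral_le.
rewrite -(fubini_tonelli F2 mF2 F20) [leRHS]integral_mkcond.
have mF2u : measurable_fun setT (fun u => \int[P]_w F2 (u, w))%E.
  exact: (measurable_fun_fubini_tonelli_F F2 mF2 F20).
apply: ge0_le_integral => //.
- by move=> u _; apply: integral_ge0 => w _; exact: F20.
- exact/(measurable_restrictT _ mD).1.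
move=> u _; rewrite patchE; case: ifPn => uD.
  have := FB u (set_mem uD); rewrite unlock; apply: le_trans.
  by rewrite /F2; under eq_integral do rewrite /= indicE uD mulr1.
rewrite /F2; under eq_integral do rewrite /= indicE (negbTE uD) mulr0.
by rewrite integral0.
Qed.

Lemma lebesgue_measure_01 (R : realType) :
  lebesgue_measure `[0, 1]%classic = 1%E :> \bar R.
Proof. by rewrite lebesgue_measure_itv/= lte_fin ltr01 sube0. Qed.

(** * Increments of the process *)

Section increments.
Context (d : measure_display) (Omega : measurableType d) (R : realType).
Variable P : probability Omega R.
Variables (T : R) (X : R -> {RV P >-> R}).

Lemma increment_even_moment_le (s t : R) k : gaussian_process T X ->
  0 <= s <= T -> 0 <= t <= T ->
  ('E_P[fun w => ((X t w - X s w) ^+ (2 * k))%R]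
    <= (gaussian_moment_const R k
        * canonical_metric X s t ^+ k)%:E)%E.
Proof.
move=> XG sT tT.
pose Y : {RV P >-> R} := (X t \- X s)%R.
have [|mean [v [v0 YG]]] := XG 2%N (fun i => if i == ord0 then t else s)
    (fun i => if i == ord0 then 1 else -1).
  by move=> i; case: ifP.
have YG' : gaussian_law P Y mean v.
  move=> A mA; rewrite -YG//; congr (P (_ @^-1` A)); apply/funext => w /=.
  by rewrite !big_ord_recl big_ord0/= addr0 mul1r mulN1r.
exact: (gaussian_even_moment_le k v0 YG').2.
Qed.

Lemma canonical_metric_ge0 s t : 0 <= canonical_metric X s t.
Proof. by rewrite fine_ge0// expectation_ge0// => w; rewrite sqr_ge0. Qed.

(** [convex_vanishing_le] applies because the metric at (s, v) is at most
    delta^2(v - s), which tends to 0 as s tends to v. *)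
Lemma canonical_metric_chord_le (delta : R -> R) (u v : R) :
  (forall s t, 0 <= s <= T -> 0 <= t <= T ->
    canonical_metric X s t <= delta `|t - s| ^+ 2) ->
  delta r ^+ 2 @[r --> 0^'+] --> 0 ->
  convex_function `[0, v[ (fun s => canonical_metric X s v) ->
  0 <= u -> u < v -> v <= T ->
  canonical_metric X u v <= (1 - u / v) * delta v ^+ 2.
Proof.
move=> Xdelta delta0 conv u0 uv vT; have v0 : 0 < v by lra.
apply: (@le_trans _ _ ((1 - u / v) * canonical_metric X 0 v)).
  apply: (convex_vanishing_le u0 uv conv).
  apply/cvgr0Pnorm_le => t t0.
  move/cvgr0Pnorm_le : delta0 => /(_ _ t0) [e /= e0 small].
  near=> w.
  have w0 : 0 < w by near: w; exact: nbhs_left_gt.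
  have wv : w < v by near: w; exact: nbhs_left_lt.
  have vwe : v - e < w by near: w; apply: nbhs_left_gt; lra.
  have wT : w <= T by lra.
  rewrite ger0_norm ?canonical_metric_ge0//.
  apply: (le_trans (Xdelta w v _ _)); rewrite ?(ltW w0) ?wT ?(ltW v0) ?vT//.
  rewrite gtr0_norm ?subr_gt0//.
  have := small (v - w); rewrite /ball/= sub0r normrN gtr0_norm ?subr_gt0//.
  rewrite [`|_ ^+ 2|]ger0_norm ?sqr_ge0//; apply => //; lra.
rewrite ler_wpM2l ?subr_ge0 ?ler_pdivrMr ?mul1r ?(ltW uv)//.
have := Xdelta 0 v; rewrite subr0 gtr0_norm// lexx (ltW v0) vT; apply => //.
by rewrite (le_trans _ vT)// ltW.
Unshelve. all: by end_near. Qed.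

End increments.

Section weighted_variation.
Context (d : measure_display) (Omega : measurableType d) (R : realType).
Variable P : probability Omega R.
Variables (T e M : R) (m : nat) (X : R -> {RV P >-> R}) (g : R -> R).
Hypothesis Xmeas : measurable_fun (`[0, T] `*` [set: Omega])
  (fun p : measurableTypeR R * Omega => X p.1 p.2).
Hypotheses (e_ge0 : 0 <= e) (eT : 1 + e <= T).
Hypotheses (gmeas : measurable_fun [set: R] g) (gM : forall x, `|g x| <= M).

Lemma weighted_increment_integral_le (B : measurableTypeR R -> \bar R) :
  measurable_fun (`[0, 1] : set (measurableTypeR R)) B ->
  (forall u : R, 0 <= u <= 1 ->
    ((M ^+ 2)%:E * 'E_P[fun w => ((X (u + e) w - X u w) ^+ (2 * m))%R]
      <= B u)%E) ->
  ('E_P[fun w => ((\int[lebesgue_measure]_(u in `[0%R, 1%R])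
      ((X (u + e) w - X u w) ^+ m * g ((X (u + e) w + X u w) / 2))) ^+ 2)%R]
    <= \int[lebesgue_measure]_(u in `[0%R, 1%R]) B u)%E.
Proof.
move=> mB XB.
(* X is jointly measurable on [0, T] only, so it is extended by 0. *)
pose Xr :=
  (fun p : measurableTypeR R * Omega => X p.1 p.2) \_ (`[0, T] `*` setT).
have mXr : measurable_fun setT Xr.
  apply/(measurable_restrictT
    (fun p : measurableTypeR R * Omega => X p.1 p.2)) => //.
  exact: measurableX.
have XrE (u : R) w : 0 <= u <= T -> Xr (u, w) = X u w.
  by move=> uT; rewrite /Xr patchE in_setX in_setT andbT mem_setE in_itv/= uT.
pose sh (p : measurableTypeR R * Omega) : measurableTypeR R * Omega :=
  (p.1 + e, p.2).
have msh : measurable_fun setT sh.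
  apply: measurable_fun_pair; last exact: measurable_snd.
  by apply: measurable_funD; [exact: measurable_fst|exact: measurable_cst].
have mXsh : measurable_fun setT (Xr \o sh) by exact: measurableT_comp.
pose F p := (Xr (sh p) - Xr p) ^+ m * g ((Xr (sh p) + Xr p) / 2).
have mF : measurable_fun setT F.
  apply: measurable_funM.
    by apply: measurable_funX; apply: measurable_funB.
  apply: (measurableT_comp gmeas).
  apply: measurable_funM; last exact: measurable_cst.
  exact: measurable_funD.
have FE (u : R) w : 0 <= u <= 1 ->
    F (u, w) = (X (u + e) w - X u w) ^+ m * g ((X (u + e) w + X u w) / 2).
  move=> /andP[u0 u1].
  have uT : 0 <= u <= T by rewrite u0 (le_trans u1)// (le_trans _ eT)// lerDl.
  have ueT : 0 <= u + e <= T by rewrite addr_ge0//= (le_trans _ eT)// lerD.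
  by rewrite /F /sh/= !XrE.
have -> : (fun w => (\int[lebesgue_measure]_(u in `[0%R, 1%R])
      ((X (u + e) w - X u w) ^+ m * g ((X (u + e) w + X u w) / 2))) ^+ 2)
   = (fun w => (\int[lebesgue_measure]_(u in `[0%R, 1%R]) F (u, w)) ^+ 2).
  apply/funext => w; congr (_ ^+ 2); apply: eq_Rintegral => u.
  by rewrite inE/= in_itv/= => u01; rewrite FE.
have mu01 := lebesgue_measure_01 R.
apply: expectation_sqr_Rintegral_le => //.
move=> /= u; rewrite in_itv/= => u01; apply: le_trans (XB _ u01).
have mXu t : measurable_fun [set: Omega] (X t) by exact: measurable_funPT.
have mD : measurable_fun [set: Omega] (fun w => X (u + e) w - X u w).
  exact: measurable_funB.
rewrite unlock -ge0_integralZl//; first last.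
- by rewrite lee_fin sqr_ge0.
- by move=> w _; rewrite lee_fin exprM exprn_ge0 ?sqr_ge0.
- by apply/measurable_EFinP; exact: measurable_funX.
apply: ge0_le_integral => //.
- by move=> w _; rewrite lee_fin sqr_ge0.
- apply/measurable_EFinP; apply: measurable_funX.
  exact: measurable_fun_pair2.
- apply: measurable_funeM; apply/measurable_EFinP; exact: measurable_funX.
move=> w _; rewrite -EFinM lee_fin FE// exprMn mulrC -exprM mulnC.
rewrite ler_wpM2r//; first by rewrite exprM exprn_ge0 ?sqr_ge0.
by rewrite -real_normK ?num_real// lerXn2r// nnegrE// (le_trans _ (gM 0)).
Qed.

End weighted_variation.

(** The factor e^2 comes out of the pointwise bound of [chord_pow_le]; what
    remains is eta times a function of integral at most 1, plus the constant
    B e. *)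
Lemma weighted_variation_second_moment_le d (Omega : measurableType d)
    (R : realType) (P : probability Omega R) (T M eta : R) (m : nat)
    (X : R -> {RV P >-> R}) (delta g : R -> R) :
  (3 <= m)%N ->
  measurable_fun (`[0, T] `*` [set: Omega])
    (fun p : measurableTypeR R * Omega => X p.1 p.2) ->
  gaussian_process T X ->
  (forall r, 0 < r -> r <= T -> delta r ^+ 2 <= delta T ^+ 2) ->
  delta =o_ (0^'+) (fun r => r `^ ((2 * m)%:R)^-1) ->
  (forall s t, 0 <= s <= T -> 0 <= t <= T ->
    canonical_metric X s t <= delta `|t - s| ^+ 2) ->
  (forall v, 0 <= v <= T ->
    increasing_concave `[0, v[ (fun u => - canonical_metric X u v)) ->
  measurable_fun [set: R] g -> (forall x, `|g x| <= M) ->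
  0 < eta -> exists2 B : R, 0 <= B &
    forall e, 0 < e -> 1 + e <= T -> ('E_P[fun w =>
      ((\int[lebesgue_measure]_(u in `[0%R, 1%R])
          ((X (u + e) w - X u w) ^+ m
           * g ((X (u + e) w + X u w) / 2))) ^+ 2)%R]
      <= (M ^+ 2 * gaussian_moment_const R m * e ^+ 2 * (eta + B * e))%:E)%E.
Proof.
move=> m_ge3 Xmeas XG dmax delta_root Xdelta conv gmeas gM.
have m0 : (0 < m)%N by rewrite (leq_trans _ m_ge3).
set K := M ^+ 2 * gaussian_moment_const R m.
have K0 : 0 <= K by rewrite mulr_ge0 ?sqr_ge0 ?gaussian_moment_const_ge0.
move=> eta0; have [B B0 powB] := root_modulus_pow_le m0 delta_root eta0 dmax.
exists B => // e e0 eT.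
have c0 : 0 <= K * e ^+ 2 by rewrite mulr_ge0 ?sqr_ge0.
have mh : measurable_fun (`[0, 1] : set (measurableTypeR R))
    (fun u : measurableTypeR R => (e / (u + e) ^+ 2)%:E).
  apply/measurable_EFinP; apply: subspace_continuous_measurable_fun => //.
  exact: continuous_sqr_inv_shift.
have mh' : measurable_fun (`[0, 1] : set (measurableTypeR R))
    (fun u => eta%:E * (e / (u + e) ^+ 2)%:E + (B * e)%:E)%E.
  by apply: emeasurable_funD; [exact: measurable_funeM|exact: measurable_cst].
have h0 (u : R) : (0 <= eta%:E * (e / (u + e) ^+ 2)%:E)%E.
  by rewrite mule_ge0// lee_fin ?divr_ge0 ?sqr_ge0 ?ltW.
have Be0 : 0 <= B * e by rewrite mulr_ge0// ltW.
apply: (@le_trans _ _ (\int[lebesgue_measure]_(u in `[0%R, 1%R])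
    ((K * e ^+ 2)%:E * (eta%:E * (e / (u + e) ^+ 2)%:E + (B * e)%:E)))%E).
  apply: (weighted_increment_integral_le (T := T) (M := M)) => //.
  - exact: ltW.
  - exact: measurable_funeM.
  move=> u /andP[u0 u1].
  have uT : 0 <= u <= T.
    by rewrite u0 (le_trans u1)// (le_trans _ eT)// lerDl ltW.
  have ueT : 0 <= u + e <= T.
    by rewrite addr_ge0 ?(ltW e0)//= (le_trans _ eT)// lerD2r.
  have h := increment_even_moment_le m XG uT ueT.
  apply: (le_trans (lee_wpmul2l _ h)); first by rewrite lee_fin sqr_ge0.
  rewrite -!EFinM lee_fin (mulrA (M ^+ 2)) -/K -(mulrA K) ler_wpM2l//.
  have ue : u < u + e by rewrite ltrDl.
  have /andP[ue0 ueT'] := ueT.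
  have cvx : convex_function `[0, (u + e)[
      (fun s => canonical_metric X s (u + e)).
    have [_] := conv _ ueT; rewrite (_ : (fun x => - - _) =
        (fun s => canonical_metric X s (u + e)))//.
    by apply/funext => s; rewrite opprK.
  have chord := canonical_metric_chord_le Xdelta
    (root_modulus_sqr_cvg0 m0 delta_root) cvx u0 ue ueT'.
  apply: le_trans (chord_pow_le m_ge3 e0 u0 (powB (u + e) _ ueT') (sqr_ge0 _)).
    rewrite lerXn2r// nnegrE ?canonical_metric_ge0//.
    by rewrite (le_trans _ chord)// canonical_metric_ge0.
  by rewrite ltr_wpDl.
have e2 (u : R) : (0 <= (e / (u + e) ^+ 2)%:E)%E.
  by rewrite lee_fin divr_ge0 ?sqr_ge0// ltW.
rewrite ge0_integralZl//; last by move=> u _; rewrite adde_ge0.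
rewrite [leRHS]EFinM lee_wpmul2l ?lee_fin// ge0_integralD//; last first.
  exact: measurable_funeM.
rewrite ge0_integralZl ?lee_fin ?(ltW eta0)// integral_cst//.
rewrite [X in (_ + _ * X)%E]lebesgue_measure_01 mule1 EFinD leeD2r//.
rewrite -[leRHS]mule1 lee_wpmul2l ?lee_fin ?(ltW eta0)//.
exact: integral_sqr_inv_shift_le1.
Qed.

(** * The limit *)

Lemma cvge0_squeeze (R : realType) (I : Type) (F : set_system I)
    (FF : Filter F) (f : I -> \bar R) :
  (forall t : R, 0 < t -> \forall x \near F, (0 <= f x <= t%:E)%E) ->
  f x @[x --> F] --> 0%E.
Proof.
move=> small; apply/fine_cvgP; split.
  apply: filterS (small 1 ltr01) => x /andP[f0 f1].
  by rewrite ge0_fin_numE// (le_lt_trans f1) ?ltry.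
apply/cvgr0Pnorm_le => t t0; apply: filterS (small t t0) => x /andP[f0 ft].
have fx : f x \is a fin_num by rewrite ge0_fin_numE// (le_lt_trans ft) ?ltry.
by rewrite /= ger0_norm ?fine_ge0// -lee_fin fineK.
Qed.

Theorem theorem14 (R : realType) (eps0 : R) (eps0_gt0 : 0 < eps0)
  (d : measure_display) (Omega : measurableType d) (P : probability Omega R)
  (m : nat) (m_ge3 : (3 <= m)%N) (m_odd : odd m)
  (X W : R -> {RV P >-> R}) (G : R -> R -> R)
  (delta : R -> R)
  (mup mun : {measure set (measurableTypeR R * measurableTypeR R) -> \bar R})
  (C a b c c' : R) :
  let T := 1 + eps0 in
  let delta2 := canonical_metric X in
  let Q := cov X in
  let Qv := var X in
  (* X is a measurable centered Gaussian process on [0, T] ... *)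
  measurable_fun (`[0, T] `*` [set: Omega])
    (fun p : measurableTypeR R * Omega => X p.1 p.2) ->
  gaussian_process T X ->
  (forall t, 0 <= t <= T -> ('E_P[X t] = 0)%E) ->
  (* ... represented as X_t = \int_0^T G(t, s) dW(s) *)
  standard_brownian_motion T W ->
  measurable_fun (`[0, T] `*` `[0, T])
    (fun p : measurableTypeR R * measurableTypeR R => G p.1 p.2) ->
  (forall t, 0 <= t <= T ->
    lebesgue_measure.-integrable `[0, T] (fun s => (G t s ^+ 2)%:E)) ->
  (forall t, 0 <= t <= T -> is_wiener_integral T W (G t) (X t)) ->
  (* the univariate delta *)
  (forall r, 0 <= r <= T -> 0 <= delta r) ->
  increasing_concave `[0, T] (fun r => delta r ^+ 2) ->
  delta =o_ (0^'+) (fun r => r `^ ((2 * m)%:R)^-1) ->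
  (forall s t, 0 <= s <= T -> 0 <= t <= T ->
    delta2 s t <= delta `|t - s| ^+ 2) ->
  (* the mixed second derivative of the bivariate delta2 *)
  signed_sigma_finite (off_diagonal T) mup mun ->
  mixed_derivative_off_diagonal T delta2 mup mun ->
  (\forall e \near 0^'+,
    (total_variation mup mun
       [set p | [/\ 0 <= p.1, p.1 <= p.2 - e & p.2 - e <= 1]%R]
     <= (C * e `^ (- ((m%:R - 1) / m%:R)))%:E)%E) ->
  (* monotonicity and concavity *)
  increasing_concave `[0, T] Qv ->
  (forall u, 0 <= u <= T -> increasing_concave `]u, T] (fun v => delta2 u v)) ->
  (forall v, 0 <= v <= T ->
    increasing_concave `[0, v[ (fun u => - delta2 u v)) ->
  (* nondegeneracy *)
  1 < a -> 0 < b -> b < 1 / 2 -> 1 / 4 < c -> 0 < c' ->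
  (\forall e \near 0^'+, forall u v, e < u -> u < v -> v <= 1 ->
    [/\ c * delta u ^+ 2 <= Qv u,
        c' * delta u ^+ 2 * delta (v - u) ^+ 2 <= Qv u * Qv v - Q u v ^+ 2 &
        a * u <= T ->
          (delta (a * u) - delta u) / ((a - 1) * u) < b * (delta u / u)]) ->
  forall g : R -> R, measurable_fun [set: R] g ->
  (exists M : R, forall x, `|g x| <= M) ->
  ((e ^- 2)%:E * 'E_P[fun w =>
      ((\int[lebesgue_measure]_(u in `[0%R, 1%R])
          ((X (u + e) w - X u w) ^+ m
           * g ((X (u + e) w + X u w) / 2))) ^+ 2)%R])%E
    @[e --> 0^'+] --> 0%E.
Proof.
move=> T delta2 Q Qv Xmeas XG _ _ _ _ _ delta0 [dmono _] delta_root Xdelta.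
move=> _ _ _ _ _ conv _ _ _ _ _ _ g gmeas [M gM].
pose K := M ^+ 2 * gaussian_moment_const R m.
have K0 : 0 <= K by rewrite mulr_ge0 ?sqr_ge0 ?gaussian_moment_const_ge0.
have dmax r : 0 < r -> r <= T -> delta r ^+ 2 <= delta T ^+ 2.
  move=> r0 rT; apply: dmono => //.
    by rewrite inE/= in_itv/= rT ltW.
  by rewrite inE/= in_itv/= lexx (le_trans (ltW r0)).
apply: cvge0_squeeze => t t0.
(* K + 1 rather than K, which may be 0 when M is. *)
have eta0 : 0 < t / (2 * (K + 1)) by rewrite divr_gt0// mulr_gt0// ltr_wpDl.
have [B B0 XB] := weighted_variation_second_moment_le m_ge3 Xmeas XG dmax
  delta_root Xdelta conv gmeas gM eta0.
near=> e.
have e0 : 0 < e by near: e; exact: nbhs_right_gt.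
have eT : 1 + e <= T by rewrite lerD2l; near: e; exact: nbhs_right_le.
have eB : e <= t / (2 * (K + 1)) / (B + 1).
  by near: e; apply: nbhs_right_le; rewrite divr_gt0// ltr_wpDl.
have e20 : 0 <= e ^- 2 by rewrite invr_ge0 sqr_ge0.
rewrite mule_ge0 ?lee_fin ?expectation_ge0//=; last first.
  by move=> w; rewrite sqr_ge0.
apply: (le_trans (lee_wpmul2l _ (XB e e0 eT))); first by rewrite lee_fin.
rewrite -EFinM lee_fin -/K.
rewrite -(mulrA K) (mulrCA K) mulKf ?expf_neq0 ?gt_eqF//.
have Be : B * e <= t / (2 * (K + 1)).
  apply: (@le_trans _ _ ((B + 1) * e)); first by rewrite ler_wpM2r ?lerDl// ltW.
  by rewrite mulrC -ler_pdivlMr// ltr_wpDl.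
apply: (@le_trans _ _ (K * (t / (2 * (K + 1)) *+ 2))).
  by rewrite ler_wpM2l// mulr2n lerD2l.
rewrite (_ : _ * _ = K / (K + 1) * t); last first.
  by field; rewrite gt_eqF// ltr_wpDl.
by rewrite ler_piMl ?(ltW t0)// ler_pdivrMr ?ltr_wpDl// mul1r lerDl.
Unshelve. all: by end_near. Qed.
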